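(* Let $t\in(-1,0)$. Define specializations (algebra homomorphisms) $\mathrm{Sym}\to\mathbb R$ by $$\Phi_m(F)=F(c_m,c_mt,\dots,c_mt^{m-1}),\quad m=1,2,\dots;\qquad \Phi_\infty(F)=F(c_\infty,c_\infty t,c_\infty t^2,\dots),$$ where $c_m=\sqrt{\dfrac{1-t^2}{1-t^{2m}}}$ and $c_\infty=\sqrt{1-t^2}$. Then for each $m\in\{1,2,\dots\}\cup\{\infty\}$ and each $\star\in\{\mathscr E,\mathscr O\}$, the restriction $\Phi$ of $\Phi_m$ to $\mathrm{Sym}^\star$ satisfies: ($p_2$-harmonicity) $\Phi(p_2F)=\Phi(F)$ for all $F\in\mathrm{Sym}^\star$; (positivity) $\Phi$ is nonnegative on the convex cone $C^{\mathrm{HL}}_\star(t)$.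
   Context: $\mathrm{Sym}$ is the graded $\mathbb R$-algebra of symmetric functions, freely generated by the power sums $p_1,p_2,\dots$. $\mathrm{Sym}^{\mathscr E}$ and $\mathrm{Sym}^{\mathscr O}$ are the subspaces spanned by homogeneous elements of even and odd degree. For a partition $\lambda$: $n(\lambda)=\sum_i(i-1)\lambda_i$, $m_i(\lambda)=\#\{j:\lambda_j=i\}$ for $i\ge1$. The Hall–Littlewood function $P_\lambda(\,;t)\in\mathrm{Sym}$ is given in $N\ge\ell(\lambda)$ variables by $$P_\lambda(x_1,\dots,x_N;t)=\frac1{v_\lambda(t)}\sum_{w\in S_N}w\Bigl(x_1^{\lambda_1}\cdots x_N^{\lambda_N}\prod_{i<j}\frac{x_i-tx_j}{x_i-x_j}\Bigr),\quad v_\lambda(t)=\prod_{i\ge0}\prod_{j=1}^{m_i}\frac{1-t^j}{1-t},$$ with $m_0=N-\ell(\lambda)$, $m_i=m_i(\lambda)$ ($i\ge1$). Put $Q_\lambda(\,;t)=\prod_{i\ge1}\prod_{j=1}^{m_i(\lambda)}(1-t^j)\cdot P_\lambda(\,;t)$ and $\widetilde Q_\lambda(\,;t)=(-1)^{n(\lambda)}Q_\lambda(\,;t)$. $C^{\mathrm{HL}}_{\mathscr E}(t)\subset\mathrm{Sym}^{\mathscr E}$ (resp. $C^{\mathrm{HL}}_{\mathscr O}(t)\subset\mathrm{Sym}^{\mathscr O}$) is the convex cone spanned by all $\widetilde Q_\lambda(\,;t)$ with $|\lambda|$ even (resp. odd). *)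

(* Defs.v *)
From HB Require Import structures.
From mathcomp Require Import all_boot all_order all_algebra all_fingroup.
From mathcomp Require Import finmap.
From mathcomp Require Import boolp classical_sets functions reals.
From mathcomp Require Import topology normedtype sequences.
(* The notations of these two files clash with those of MathComp-Analysis. *)
From mathcomp Require Import -(notations) mpoly monalg.

Set Implicit Arguments.
Unset Strict Implicit.
Unset Printing Implicit Defensive.

Import Order.TTheory GRing.Theory Num.Theory.
Import numFieldNormedType.Exports.

Local Open Scope classical_set_scope.
Local Open Scope ring_scope.

(* The monomials p_1^a_1 p_2^a_2 ... in the power sums: the multiplicity of the
   index k : nat is the exponent of p_(k+1). *)
Notation pmonom := (cmonom nat).

(* The polynomial algebra R[p_1, p_2, ...]. *)
Notation SymFun R := (malg pmonom R).

(* For k >= 1; psum R 0 is a junk value. *)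
Definition psum (R : realType) (k : nat) : SymFun R :=
  mkmalgU (ucm k.-1 : pmonom) 1.

Section Specialization.
Variables (R : realType) (A : comAlgType R) (v : nat -> A).

Definition pmonom_eval (m : pmonom) : A :=
  \prod_(k <- finsupp (cmonom_val m)) v k.+1 ^+ cmonom_val m k.

(* The algebra homomorphism Sym -> A with p_k |-> v k for all k >= 1. *)
Definition sym_spec : SymFun R -> A := mmap (in_alg A) pmonom_eval.

Lemma pmonom_evalEw (d : {fset nat}) (m : pmonom) :
  (finsupp (cmonom_val m) `<=` d)%fset ->
  pmonom_eval m = \prod_(k <- d) v k.+1 ^+ cmonom_val m k.
Proof.
move=> le; rewrite /pmonom_eval (big_fset_incl _ le) // => k _.
by rewrite -cmE_eq0 => /eqP ->; rewrite expr0.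
Qed.

Lemma pmonom_eval_mmorphism : mmorphism pmonom_eval.
Proof.
split=> [m1 m2|]; last by rewrite /pmonom_eval mdom1 big_seq_fset0.
set d := (finsupp (cmonom_val m1) `|` finsupp (cmonom_val m2))%fset.
rewrite (@pmonom_evalEw d) ?mdomD //.
rewrite (@pmonom_evalEw d m1) ?fsubsetUl // (@pmonom_evalEw d m2) ?fsubsetUr //.
rewrite -big_split /=.
by apply: eq_bigr => k _; rewrite cmM exprD.
Qed.

HB.instance Definition _ :=
  monalg.isMultiplicative.Build pmonom A pmonom_eval pmonom_eval_mmorphism.

HB.instance Definition _ := GRing.RMorphism.copy sym_spec
  (mmap (in_alg A) pmonom_eval).

Lemma sym_spec_scalable : scalable sym_spec.
Proof. by move=> c F; rewrite /sym_spec mmapZ /= mulr_algl. Qed.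

HB.instance Definition _ :=
  GRing.isScalable.Build R (SymFun R) A *:%R sym_spec sym_spec_scalable.

Lemma sym_spec_psum k : (0 < k)%N -> sym_spec (psum R k) = v k.
Proof.
case: k => // k _; rewrite /sym_spec mmapU /= scale1r mul1r.
by rewrite /pmonom_eval mdomU big_seq_fset1 cmUU expr1.
Qed.

End Specialization.

(* F(x_1, ..., x_N) *)
Definition sym_eval (R : realType) (A : comAlgType R) (N : nat) (x : 'I_N -> A) :
    {lrmorphism SymFun R -> A} :=
  sym_spec (fun k => \sum_(i < N) x i ^+ k).

Definition pweight (m : pmonom) : nat :=
  (\sum_(k <- finsupp (cmonom_val m)) cmonom_val m k * k.+1)%N.

Definition homogeneous (R : realType) (d : nat) (F : SymFun R) : Prop :=
  forall m : pmonom, m \in monalg.msupp F -> pweight m = d.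

Definition linear_span (R : realType) (V : lmodType R) (S : set V) : set V :=
  [set v | exists (n : nat) (a : 'I_n -> R) (u : 'I_n -> V),
    (forall i, S (u i)) /\ v = \sum_(i < n) a i *: u i].

Definition convex_cone (R : realType) (V : lmodType R) (S : set V) : set V :=
  [set v | exists (n : nat) (a : 'I_n -> R) (u : 'I_n -> V),
    [/\ forall i, 0 <= a i, forall i, S (u i) &
        v = \sum_(i < n) a i *: u i]].

(* A parity is encoded as a boolean, with true for odd. *)
Definition Sym_part (R : realType) (parity : bool) : set (SymFun R) :=
  linear_span [set F | exists2 d, odd d = parity & homogeneous d F].

Definition is_partition (lam : seq nat) : bool :=
  sorted geq lam && (0%N \notin lam).

Definition part_n (lam : seq nat) : nat :=
  (\sum_(i < size lam) i * nth 0 lam i)%N.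

(* m_i(lam) for i >= 1, and m_0 = N - l(lam). *)
Definition part_mult (N : nat) (lam : seq nat) (i : nat) : nat :=
  if i is 0%N then (N - size lam)%N else count_mem i lam.

Section HallLittlewoodFormula.
Variables (K : fieldType) (t : K) (N : nat) (lam : seq nat).

(* The parts of lam are at most |lam|, so m_i(lam) = 0 for i > |lam|. *)
Definition hl_v : K :=
  \prod_(0 <= i < (sumn lam).+1) \prod_(1 <= j < (part_mult N lam i).+1)
    ((1 - t ^+ j) / (1 - t)).

Definition hl_formula (x : 'I_N -> K) : K :=
  hl_v^-1 * \sum_(w : 'S_N)
    ((\prod_(i < N) x (w i) ^+ nth 0%N lam i) *
     \prod_(i < N) \prod_(j < N | (i < j)%N)
       ((x (w i) - t * x (w j)) / (x (w i) - x (w j)))).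

End HallLittlewoodFormula.

Section HallLittlewood.
Variables (R : realType) (t : R).

(* For every N >= l(lam), the image of P in N variables is given by the
   symmetrization formula, read in the field of rational functions. *)
Definition is_HL_P (lam : seq nat) (P : SymFun R) : Prop :=
  forall N, (size lam <= N)%N ->
    tofrac (sym_eval (fun i : 'I_N => mpolyX R (mnm1 i)) P) =
    hl_formula (tofrac (mpolyC N t)) lam
      (fun i : 'I_N => tofrac (mpolyX R (mnm1 i))).

(* By the stability of the formula in N there is exactly one such P when lam is
   a partition and -1 < t < 1, so the default value 0 plays no role then. *)
Definition HL_P (lam : seq nat) : SymFun R := xget 0 [set P | is_HL_P lam P].

Definition HL_b (lam : seq nat) : R :=
  \prod_(1 <= i < (sumn lam).+1) \prod_(1 <= j < (count_mem i lam).+1)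
    (1 - t ^+ j).

Definition HL_Q (lam : seq nat) : SymFun R := HL_b lam *: HL_P lam.

Definition HL_Qtilde (lam : seq nat) : SymFun R :=
  (-1) ^+ part_n lam *: HL_Q lam.

Definition HL_cone (parity : bool) : set (SymFun R) :=
  convex_cone [set F | exists lam : seq nat,
    [/\ is_partition lam, odd (sumn lam) = parity & F = HL_Qtilde lam]].

Definition Phi_fin (m : nat) : {lrmorphism SymFun R -> R^o} :=
  let c := Num.sqrt ((1 - t ^+ 2) / (1 - t ^+ (2 * m)%N)) in
  sym_eval (fun i : 'I_m => c * t ^+ i : R^o).

(* F(x_0, x_1, x_2, ...) for the infinite sequence x_i = c t^i: the power sum p_k
   is sent to the sum of the convergent series of the x_i^k. *)
Definition Phi_inf : {lrmorphism SymFun R -> R^o} :=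
  let c := Num.sqrt (1 - t ^+ 2) in
  sym_spec (fun k => limn (series (fun i => (c * t ^+ i) ^+ k)) : R^o).

(* None stands for m = oo. *)
Definition Phi (m : option nat) : {lrmorphism SymFun R -> R^o} :=
  if m is Some m' then Phi_fin m' else Phi_inf.

End HallLittlewood.

(* Main.v *)
(* At a geometric progression c, ct, ..., ct^(N-1) the factors x_(w i) - t x_(w j)
   kill every term of the symmetrization except w = 1, so that for N >= l(lam)
     P_lam = v_lam(t)^-1 c^|lam| t^n(lam)
             prod_(i < j) (1 - t^(j-i+1)) / (1 - t^(j-i)),
   whose sign is (-1)^n(lam) when -1 < t < 0. For N < l(lam) the function P_lam
   vanishes in N variables, being divisible by each of them. The case of
   infinitely many variables follows by passing to the limit. Harmonicity holds
   because p_2 is sent to 1. *)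

Require Import Defs.
From HB Require Import structures.
From mathcomp Require Import all_boot all_order all_algebra all_fingroup.
From mathcomp Require Import finmap boolp classical_sets reals.
From mathcomp Require Import topology normedtype sequences.
From mathcomp Require Import -(notations) mpoly monalg.

Set Implicit Arguments.
Unset Strict Implicit.
Unset Printing Implicit Defensive.

Import Order.TTheory GRing.Theory Num.Theory.
Import numFieldNormedType.Exports.

Local Open Scope classical_set_scope.
Local Open Scope ring_scope.

(** * Functoriality and continuity of specializations of Sym *)

Lemma rmorph_sym_spec (R : realType) (A B : comAlgType R)
    (f : {rmorphism A -> B}) (v : nat -> A) (F : SymFun R) :
  (forall c : R, f c%:A = c%:A) -> f (sym_spec v F) = sym_spec (f \o v) F.
Proof.
move=> fA; rewrite /sym_spec /monalg.mmap rmorph_sum /=.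
apply: eq_bigr => m _; rewrite rmorphM /= fA; congr (_ * _).
by rewrite /pmonom_eval rmorph_prod; apply: eq_bigr => k _; rewrite rmorphXn.
Qed.

Lemma eq_sym_spec (R : realType) (A : comAlgType R) (v v' : nat -> A)
    (F : SymFun R) :
  (forall k, v k.+1 = v' k.+1) -> sym_spec v F = sym_spec v' F.
Proof.
move=> vv'; rewrite /sym_spec /monalg.mmap; apply: eq_bigr => m _; congr (_ * _).
by rewrite /pmonom_eval; apply: eq_bigr => k _; rewrite vv'.
Qed.

Lemma rmorph_sym_eval (R : realType) (A B : comAlgType R)
    (f : {rmorphism A -> B}) (N : nat) (x : 'I_N -> A) (F : SymFun R) :
  (forall c : R, f c%:A = c%:A) -> f (sym_eval x F) = sym_eval (f \o x) F.
Proof.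
move=> fA; rewrite /sym_eval rmorph_sym_spec //; apply: eq_sym_spec => k /=.
by rewrite rmorph_sum; apply: eq_bigr => i _; rewrite rmorphXn.
Qed.

(** [F] is a finite linear combination of finite products of power sums, so its value depends
    continuously on theirs. *)
Lemma cvg_sym_spec (R : realType) (v : nat -> nat -> R^o) (l : nat -> R^o)
    (F : SymFun R) :
  (forall k, (0 < k)%N -> v n k @[n --> \oo] --> l k) ->
  sym_spec (v n) F @[n --> \oo] --> sym_spec l F.
Proof.
move=> vl; rewrite /sym_spec /monalg.mmap.
apply: (@cvg_big R^o _ +%R 0 xpredT) => [|m _]; first exact: add_continuous.
apply: (@cvgM R^o); first exact: cvg_cst.
rewrite /pmonom_eval.
apply: (@cvg_big R^o _ *%R 1 xpredT) => [|k _]; first exact: mul_continuous.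
elim: (cmonom_val m k) => [|e IH].
  by rewrite expr0; under eq_fun do rewrite expr0; exact: cvg_cst.
rewrite exprS; under eq_fun do rewrite exprS.
by apply: (@cvgM R^o) => //; exact: vl.
Qed.

(** * Permutations, and the Hall-Littlewood sum with denominators cleared *)

Lemma perm_increasing_eq1 (n : nat) (s : {perm 'I_n}) :
  (forall i j : 'I_n, j = i.+1 :> nat -> (s i < s j)%N) -> s = 1%g.
Proof.
move=> incr; apply/permP => i; rewrite perm1.
have ge_s : forall j : 'I_n, (j <= s j)%N.
  case=> j; elim: j => [|j IH] lt_jn //=.
  have lt_jn' := ltnW lt_jn.
  exact: leq_ltn_trans (IH lt_jn') (incr (Ordinal lt_jn') (Ordinal lt_jn) erefl).
(* Each [j <= s j], while both sides have the same total over [j]; this forces equality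
   throughout. *)
have sum_s : (\sum_(j < n) j = \sum_(j < n) s j)%N.
  by rewrite (reindex_inj (@perm_inj _ s)).
have := leqif_sum (fun (j : 'I_n) (_ : true) => leqif_eq (ge_s j)).
move=> [_]; rewrite -sum_s eqxx => /esym/forallP /(_ i) /= /eqP eq_i.
exact/esym/val_inj.
Qed.

(* The product over ordered pairs avoids the sign of the Vandermonde product. *)
Definition discr (A : comNzRingType) (N : nat) (x : 'I_N -> A) : A :=
  \prod_(i < N) \prod_(j < N | j != i) (x i - x j).

(** The symmetrization sum times [discr x], without the factor 1 / [hl_v]. Being free of division,
    it makes sense in every commutative ring and is preserved by ring morphisms. The factors with
    [j < i] are the half of [discr x] that no denominator cancels. *)
Definition hl_numer (A : comNzRingType) (t : A) (N : nat) (lam : seq nat)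
    (x : 'I_N -> A) : A :=
  \sum_(w : 'S_N) (\prod_(i < N) x (w i) ^+ nth 0%N lam i) *
    \prod_(i < N) ((\prod_(j < N | (i < j)%N) (x (w i) - t * x (w j))) *
                   \prod_(j < N | (j < i)%N) (x (w i) - x (w j))).

Lemma rmorph_discr (A B : comNzRingType) (f : {rmorphism A -> B}) (N : nat)
    (x : 'I_N -> A) : f (discr x) = discr (f \o x).
Proof.
rewrite /discr rmorph_prod; apply: eq_bigr => i _.
by rewrite rmorph_prod; apply: eq_bigr => j _; rewrite rmorphB.
Qed.

Lemma rmorph_hl_numer (A B : comNzRingType) (f : {rmorphism A -> B}) (t : A)
    (N : nat) (lam : seq nat) (x : 'I_N -> A) :
  f (hl_numer t lam x) = hl_numer (f t) lam (f \o x).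
Proof.
rewrite /hl_numer rmorph_sum; apply: eq_bigr => w _.
rewrite rmorphM !rmorph_prod; congr (_ * _).
  by apply: eq_bigr => i _; rewrite rmorphXn.
apply: eq_bigr => i _; rewrite rmorphM !rmorph_prod; congr (_ * _).
  by apply: eq_bigr => j _; rewrite rmorphB rmorphM.
by apply: eq_bigr => j _; rewrite rmorphB.
Qed.

Lemma rmorph_hl_v (K L : fieldType) (f : {rmorphism K -> L}) (t : K)
    (N : nat) (lam : seq nat) : f (hl_v t N lam) = hl_v (f t) N lam.
Proof.
rewrite /hl_v rmorph_prod; apply: eq_bigr => i _.
rewrite rmorph_prod; apply: eq_bigr => j _.
by rewrite fmorph_div !rmorphB rmorphXn rmorph1.
Qed.

Lemma discr_neq0 (D : idomainType) (N : nat) (x : 'I_N -> D) :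
  injective x -> discr x != 0.
Proof.
move=> x_inj; rewrite prodf_seq_neq0; apply/allP => i _ /=.
rewrite prodf_seq_neq0; apply/allP => j _; apply/implyP => ji.
by rewrite subr_eq0 (inj_eq x_inj) eq_sym.
Qed.

Lemma hl_formula_cleared (K : fieldType) (t : K) (N : nat) (lam : seq nat)
    (x : 'I_N -> K) :
  injective x -> hl_v t N lam != 0 ->
  hl_v t N lam * (hl_formula t lam x * discr x) = hl_numer t lam x.
Proof.
move=> x_inj v0; rewrite /hl_formula -mulrA mulVKf // mulr_suml.
apply: eq_bigr => w _; rewrite -mulrA; congr (_ * _).
(* [discr] is invariant under [w], and its half with [i < j] cancels the denominators of the term of
   [w]. *)
have -> : discr x =
    \prod_(i < N) ((\prod_(j < N | (i < j)%N) (x (w i) - x (w j))) *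
                   \prod_(j < N | (j < i)%N) (x (w i) - x (w j))).
  rewrite /discr (reindex_inj (@perm_inj _ w)); apply: eq_bigr => i _ /=.
  rewrite (reindex_inj (@perm_inj _ w)) /= (bigID (fun j : 'I_N => (i < j)%N)) /=.
  by congr (_ * _); apply: eq_bigl => j;
    rewrite (inj_eq perm_inj) -val_eqE /= neq_ltn; case: ltngtP.
rewrite -big_split /=; apply: eq_bigr => i _.
rewrite mulrA -big_split /=; congr (_ * _); apply: eq_bigr => j ij.
rewrite divfK // subr_eq0 (inj_eq x_inj) (inj_eq perm_inj).
by rewrite -val_eqE ltn_eqF.
Qed.

Lemma mpolyX_mnm1_inj (R : nzRingType) (N : nat) :
  injective (fun i : 'I_N => mpolyX R (mnm1 i)).
Proof.
move=> i j /(congr1 (mpoly.mcoeff (mnm1 i))); rewrite !mpoly.mcoeffX eqxx.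
case: eqP => [/(congr1 (fun m : multinom N => m i))|_ /eqP].
  by rewrite !mnm1E eqxx; case: eqP.
by rewrite oner_eq0.
Qed.

(** * Values at geometric progressions for -1 < t < 0 *)

Section Positivity.
Variables (R : realType) (t : R).
Hypothesis ht : -1 < t < 0.

Let normt_lt1 : `|t| < 1.
Proof. by case/andP: ht => t1 t0; rewrite ltr_norml t1 (lt_trans t0). Qed.

Let t_neq0 : t != 0.
Proof. by case/andP: ht => _ /lt_eqF ->. Qed.

Let normX_lt1 k : (0 < k)%N -> `|t ^+ k| < 1.
Proof. by case: k => // k _; rewrite normrX exprn_ilt1. Qed.

Let onemX_gt0 k : (0 < k)%N -> 0 < 1 - t ^+ k.
Proof.
by move=> k_gt0; rewrite subr_gt0 (le_lt_trans (ler_norm _)) // normX_lt1.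
Qed.

Lemma hl_v_gt0 N lam : 0 < hl_v t N lam.
Proof.
apply: prodr_gt0 => i _; rewrite big_nat; apply: prodr_gt0 => j /andP[j_gt0 _].
by rewrite divr_gt0 ?onemX_gt0 // -[t in 1 - t]expr1 onemX_gt0.
Qed.

Lemma HL_b_gt0 lam : 0 < HL_b t lam.
Proof.
apply: prodr_gt0 => i _; rewrite big_nat; apply: prodr_gt0 => j /andP[j_gt0 _].
exact: onemX_gt0.
Qed.

Lemma geometric_diff (c : R) (i j : nat) : (i < j)%N ->
  c * t ^+ i - c * t ^+ j = c * t ^+ i * (1 - t ^+ (j - i)).
Proof. by move=> ij; rewrite mulrBr mulr1 -mulrA -exprD subnKC // ltnW. Qed.

Lemma geometric_inj N (c : R) : 0 < c ->
  injective (fun i : 'I_N => c * t ^+ i : R^o).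
Proof.
move=> c_gt0.
have neq (i j : 'I_N) : (i < j)%N -> c * t ^+ i != c * t ^+ j.
  move=> ij; rewrite -subr_eq0 geometric_diff // !mulf_neq0 ?expf_neq0 //.
    by rewrite lt0r_neq0.
  by rewrite lt0r_neq0 // onemX_gt0 // subn_gt0.
move=> i j eq_ij; apply: val_inj.
by case: (ltngtP i j) => // /neq; rewrite eq_ij eqxx.
Qed.

Section GivenHL.
Variables (lam : seq nat) (P : SymFun R).
Hypothesis P_HL : is_HL_P t lam P.

(* With the denominators cleared, the formula can be specialized to points
   whose coordinates are not invertible or not distinct. *)
Lemma HL_P_cleared (A : comAlgType R) N (x : 'I_N -> A) : (size lam <= N)%N ->
  (hl_v t N lam)%:A * (sym_eval x P * discr x) = hl_numer t%:A lam x.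
Proof.
move=> le_lamN; pose X (i : 'I_N) := mpolyX R (mnm1 i).
pose iota : {rmorphism R -> {fraction (mpoly N R)}} :=
  @tofrac (mpoly N R) \o @mpolyC N R.
(* For indeterminates the identity is proved in the fraction field, where they are distinct, and
   descends to polynomials since [tofrac] is injective. Substituting [x] then gives it in [A]. *)
have E : mpolyC N (hl_v t N lam) * (sym_eval X P * discr X) =
    hl_numer (mpolyC N t) lam X.
  have PX : tofrac (sym_eval X P) = hl_formula (iota t) lam (fun i => tofrac (X i)).
    exact: P_HL.
  apply/eqP; rewrite -tofrac_eq; apply/eqP.
  rewrite rmorph_hl_numer -hl_formula_cleared.
  - by rewrite !rmorphM rmorph_discr /= PX -(rmorph_hl_v iota).
  - by move=> i j /= /eqP; rewrite tofrac_eq => /eqP /mpolyX_mnm1_inj.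
  - by rewrite -(rmorph_hl_v iota) fmorph_eq0 gt_eqF // hl_v_gt0.
pose ev : {rmorphism mpoly N R -> A} := mpoly.mmap (in_alg A) x.
have evX : ev \o X = x.
  by apply: funext => i; rewrite /= mpoly.mmapX mpoly.mmap1U.
have evC c : ev (mpolyC N c) = c%:A by rewrite /= mpoly.mmapC.
have := congr1 ev E; rewrite !rmorphM rmorph_hl_numer rmorph_discr.
rewrite rmorph_sym_eval ?evX ?evC // => c.
by rewrite -mul_mpolyC rmorphM rmorph1 mulr1 evC.
Qed.

(** At distinct real points [discr x] and [hl_v] are nonzero, so the cleared identity can be divided
    back. *)
Lemma sym_eval_HL N (x : 'I_N -> R^o) : injective x -> (size lam <= N)%N ->
  sym_eval x P = hl_formula t lam x.
Proof.
move=> x_inj le_lamN; have v0 := lt0r_neq0 (hl_v_gt0 N lam).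
apply: (mulIf (@discr_neq0 R N x x_inj)); apply: (mulfI v0).
rewrite hl_formula_cleared //; have := HL_P_cleared x le_lamN.
by rewrite /GRing.scale /= !mulr1.
Qed.

(** If [w] is not the identity, it takes some value k + 1 at an earlier position than k, and the
    factor of that pair of positions has numerator c t^(k+1) - t c t^k = 0. *)
Lemma geometric_perm_vanish N (c : R) (w : 'S_N) : w != 1%g ->
  \prod_(i < N) \prod_(j < N | (i < j)%N)
    ((c * t ^+ w i - t * (c * t ^+ w j)) / (c * t ^+ w i - c * t ^+ w j)) = 0.
Proof.
move=> w_neq1; apply: contra_neq_eq w_neq1 => prod_neq0.
apply: invg_inj; rewrite invg1; apply: perm_increasing_eq1 => k l lk.
rewrite ltnNge leq_eqVlt; apply/negP.
move=> /orP[/eqP /val_inj /perm_inj kl|lt_lk].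
  by move: lk; rewrite kl => /esym/eqP; rewrite gtn_eqF.
move: prod_neq0; rewrite (bigD1 ((w^-1)%g l)) //= (bigD1 ((w^-1)%g k)) //=.
by rewrite !permKV lk exprS mulrCA subrr !mul0r eqxx.
Qed.

Lemma sym_eval_HL_geometric_ge0 N (c : R) : 0 < c -> (size lam <= N)%N ->
  0 <= (-1) ^+ part_n lam * sym_eval (fun i : 'I_N => c * t ^+ i : R^o) P.
Proof.
move=> c_gt0 le_lamN.
have diffE := geometric_diff c.
have x_inj := @geometric_inj N c c_gt0.
rewrite sym_eval_HL // /hl_formula (bigD1 1%g) //= [X in _ + X]big1 ?addr0;
  last first.
  by move=> w /(geometric_perm_vanish c) ->; rewrite mulr0.
rewrite mulrCA mulr_ge0 // ?invr_ge0 ?(ltW (hl_v_gt0 _ _)) //.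
rewrite mulrA mulr_ge0 //; last first.
  apply: prodr_ge0 => i _; apply: prodr_ge0 => j ij; rewrite !perm1.
  (* Numerator and denominator share the factor c t^i, of either sign; what remains is a quotient of
     positive numbers. *)
  have -> : c * t ^+ i - t * (c * t ^+ j) = c * t ^+ i * (1 - t ^+ (j - i).+1).
    by rewrite mulrCA -exprS diffE ?subSn // ltnW.
  rewrite diffE // -mulf_div divff ?mul1r ?mulf_neq0 ?expf_neq0
    ?(lt0r_neq0 c_gt0) //.
  by rewrite divr_ge0 // ltW // onemX_gt0 // subn_gt0.
have -> : \prod_(i < N) (c * t ^+ (1%g : 'S_N) i) ^+ nth 0%N lam i =
    \prod_(i < N) c ^+ nth 0%N lam i * t ^+ part_n lam.
  rewrite (eq_bigr (fun i : 'I_N =>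
    c ^+ nth 0%N lam i * t ^+ (i * nth 0%N lam i))) => [|i _]; last first.
    by rewrite perm1 exprMn -exprM.
  rewrite big_split /=; congr (_ * _); rewrite prodrXr /part_n; congr (t ^+ _).
  (* Indices from [size lam] to [N] contribute 0, the default value of [nth]. *)
  rewrite -!(big_mkord xpredT (fun i => i * nth 0 lam i)%N).
  rewrite (big_cat_nat (leq0n _) le_lamN) //= big_mkord [X in (_ + X)%N]big_nat.
  rewrite [X in (_ + X)%N]big1 ?addn0 // => i /andP[? _].
  by rewrite nth_default ?muln0.
(* The sign is absorbed into (-t)^n(lam), and -t > 0. *)
rewrite mulrCA -exprMn mulN1r mulr_ge0 //.
  by apply: prodr_ge0 => i _; rewrite exprn_ge0 // ltW.
by rewrite exprn_ge0 // oppr_ge0 ltW //; case/andP: ht.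
Qed.

(* The size lam - m missing variables are first set to 0, 'X, 2'X, ... in R['X],
   which are distinct, so that the discriminant does not vanish, and 'X to 0 only
   afterwards. *)
Lemma sym_eval_HL_lt_size m (y : 'I_m -> R^o) : 0%N \notin lam -> injective y ->
  (forall i, y i != 0) -> (m < size lam)%N -> sym_eval y P = 0.
Proof.
move=> lam0 y_inj y_neq0 lt_m; pose k := (size lam - m)%N.
have size_lam : size lam = (m + k)%N by rewrite subnKC // ltnW.
pose x (i : 'I_(m + k)) : {poly R} :=
  match split i with inl j => (y j)%:P | inr j => j%:R *: 'X end.
have xl j : x (lshift k j) = (y j)%:P.
  rewrite /x; case: split_ordP => // i /eqP.
  - by rewrite eq_lshift => /eqP ->.
  - by rewrite eq_lrshift.
have xr j : x (rshift m j) = j%:R *: 'X.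
  rewrite /x; case: split_ordP => // i /eqP.
  - by rewrite eq_rlshift.
  - by rewrite eq_rshift => /eqP ->.
have x_inj : injective x.
  (* Evaluation at 0 separates the nonzero constants from the multiples of ['X]. *)
  have neq i j : (y i)%:P <> j%:R *: 'X :> {poly R}.
    by move=> /(congr1 (horner^~ 0)) /eqP; rewrite !hornerE; apply/negP.
  move=> i j; case: (split_ordP i) => i' ->; case: (split_ordP j) => j' ->;
    rewrite ?xl ?xr.
  - by move/polyC_inj/y_inj->.
  - by move/neq.
  - by move/esym/neq.
  - move/(congr1 (horner^~ 1)); rewrite !hornerE => /eqP; rewrite eqr_nat.
    by move/eqP/val_inj->.
have k_gt0 : (0 < k)%N by rewrite subn_gt0.
have x0 : x (rshift m (Ordinal k_gt0)) = 0 by rewrite xr scale0r.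
(* With exactly [size lam] variables every exponent is a part of [lam], hence positive, so the
   variable equal to 0 kills each term. *)
have numer0 : hl_numer t%:A lam x = 0.
  rewrite /hl_numer big1 // => w _.
  rewrite (bigD1 ((w^-1)%g (rshift m (Ordinal k_gt0)))) //= permKV x0.
  rewrite expr0n; case: eqP => [nth0|_]; last by rewrite !mul0r.
  case/negP: lam0; rewrite -nth0 mem_nth // size_lam; exact: ltn_ord.
have := @HL_P_cleared {poly R} (m + k) x; rewrite size_lam leqnn => /(_ isT).
rewrite numer0 => /eqP; rewrite mulf_eq0 mulf_eq0 (negPf (discr_neq0 x_inj)) orbF.
rewrite scaler_eq0 oner_eq0 orbF gt_eqF ?hl_v_gt0 //= => /eqP xP.
pose ev : {rmorphism {poly R} -> R^o} := horner_eval (0 : R).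
have := congr1 ev xP; rewrite rmorph0 rmorph_sym_eval => [xP0|c]; last first.
  by rewrite /ev /= /horner_eval !hornerE /GRing.scale /= mulr1.
(* Only positive exponents are compared, so the added zeros contribute nothing; at exponent 0 each
   would add 1. *)
rewrite -[RHS]xP0 /sym_eval; apply: eq_sym_spec => e.
rewrite big_split_ord /= [X in _ = _ + X]big1 ?addr0 => [|j _]; last first.
  by rewrite /= xr /ev /= /horner_eval !hornerE expr0n.
by apply: eq_bigr => i _; rewrite /= xl /ev /= /horner_eval !hornerE.
Qed.

End GivenHL.

(** * Positivity of [Phi] and its value at p_2 *)

Lemma sym_eval_Qtilde_ge0 N (c : R) lam : 0 < c -> is_partition lam ->
  0 <= sym_eval (fun i : 'I_N => c * t ^+ i : R^o) (HL_Qtilde t lam).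
Proof.
move=> c_gt0 /andP[_ lam0]; rewrite /HL_Qtilde /HL_Q /HL_P.
(* Either [xget] returns some [P] satisfying the formula, or it returns the default 0, whose image
   is 0. *)
case: xgetP => [P _ P_HL|_]; last by rewrite !scaler0 raddf0.
rewrite scalerA mulrC -scalerA !linearZ /=; apply: mulr_ge0.
  exact/ltW/HL_b_gt0.
have [/(sym_eval_HL_geometric_ge0 P_HL c_gt0) //|lt_N] := leqP (size lam) N.
rewrite (sym_eval_HL_lt_size P_HL lam0 (geometric_inj c_gt0)) ?scaler0 //.
by move=> i; rewrite mulf_neq0 ?expf_neq0 ?(lt0r_neq0 c_gt0).
Qed.

Let geometricX (c : R) k :
  (fun i => (c * t ^+ i) ^+ k) = geometric (c ^+ k) (t ^+ k).
Proof. by apply: funext => i /=; rewrite exprMn -!exprM mulnC. Qed.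

(** The truncations keep the scale of the infinite progression, so they are not the [Phi_fin];
    [sym_eval_Qtilde_ge0] applies to them because it allows any [c > 0]. The p_k converge as
    geometric series of ratio t^k. *)
Lemma cvg_Phi_inf (F : SymFun R) :
  sym_eval (fun i : 'I_n => Num.sqrt (1 - t ^+ 2) * t ^+ i : R^o) F @[n --> \oo]
    --> Phi_inf t F.
Proof.
apply: cvg_sym_spec => k k_gt0.
rewrite geometricX.
set c := Num.sqrt _.
have cvg_geo := @is_cvg_geometric_series R (c ^+ k) _ (normX_lt1 k_gt0).
rewrite [X in X @ \oo](_ : _ = series (geometric (c ^+ k) (t ^+ k))).
  exact: cvg_geo.
by apply: funext => n; rewrite -geometricX /series /= big_mkord.
Qed.

Lemma Phi_Qtilde_ge0 m lam : m <> Some 0%N -> is_partition lam ->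
  0 <= Phi t m (HL_Qtilde t lam).
Proof.
case: m => [m|] m0 lamP /=.
  case: m m0 => [//|m] _; apply: sym_eval_Qtilde_ge0 => //.
  by rewrite sqrtr_gt0 divr_gt0 // onemX_gt0.
have cvgF := @cvg_Phi_inf (HL_Qtilde t lam).
rewrite -(cvg_lim _ cvgF) //; apply: limr_ge.
  by apply/cvg_ex; eexists; exact: cvgF.
near=> n; apply: sym_eval_Qtilde_ge0 => //.
by rewrite sqrtr_gt0 onemX_gt0.
Unshelve. all: by end_near. Qed.

Lemma Phi_psum2 m : m <> Some 0%N -> Phi t m (psum R 2) = 1.
Proof.
have sqrtE (y : R) : 0 < y -> Num.sqrt y ^+ 2 = y by move=> /ltW; exact: sqr_sqrtr.
case: m => [[//|m]|] _; rewrite /= sym_spec_psum //.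
  under eq_bigr => i _ do rewrite exprMn sqrtE ?divr_gt0 ?onemX_gt0 // exprAC.
  (* The geometric sum gives (1 - t^2) times the sum of the t^(2i) as 1 - t^(2m), the denominator of
     c_m^2. *)
  rewrite -mulr_sumr mulrAC -[1 - _]opprB mulNr -subrX1 opprB -exprM.
  by rewrite divff // lt0r_neq0 // onemX_gt0.
rewrite geometricX.
have := @cvg_geometric_series R (Num.sqrt (1 - t ^+ 2) ^+ 2) _ (normX_lt1 (ltn0Sn 1)).
move=> /cvg_lim -> //.
by rewrite sqrtE ?onemX_gt0 // divff // lt0r_neq0 // onemX_gt0.
Qed.

End Positivity.

Theorem proposition8p13 (R : realType) (t : R) (ht : -1 < t < 0)
    (m : option nat) (hm : m <> Some 0%N) (parity : bool) :
  (forall F : SymFun R, Sym_part parity F ->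
     Phi t m (psum R 2 * F) = Phi t m F) /\
  (forall F : SymFun R, HL_cone t parity F -> 0 <= Phi t m F).
Proof.
split=> [F _|F [n [a [u [a_ge0 uQ ->]]]]].
  by rewrite rmorphM /= Phi_psum2 // mul1r.
rewrite linear_sum; apply: sumr_ge0 => i _; rewrite linearZ.
have [lam [lamP _ ->]] := uQ i.
by apply: mulr_ge0 => //; exact: Phi_Qtilde_ge0.
Qed.
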